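(* Let $\mathfrak{E}$ be a complex Banach space, let $S$ be a non-empty set, and let $\mathsf{K}$ and $\mathsf{L}$ be kernels (positive definite operator functions) on $S$ with values in $\mathbf{B}(\mathfrak{E},\mathfrak{E}^* )$. Then $\mathsf{K}$ splits into $\mathsf{L}$-closable and $\mathsf{L}$-singular parts; that is, there exist kernels $\mathsf{K}_r$ and $\mathsf{K}_s$ on $S$ such that $\mathsf{K}=\mathsf{K}_r+\mathsf{K}_s$ (pointwise), where $\mathsf{K}_r$ is $\mathsf{L}$-closable and $\mathsf{K}_s$ is $\mathsf{L}$-singular.
   Context: A form on a complex linear space $\mathfrak{X}$ is a map $\mathfrak{t}:\mathfrak{X}\times\mathfrak{X}\to\mathbb{C}$ that is linear in its first argument, anti-linear in its second argument, and satisfies $\mathfrak{t}[x]:=\mathfrak{t}(x,x)\ge 0$ for all $x\in\mathfrak{X}$. Write $\mathfrak{t}\le\mathfrak{w}$ if $\mathfrak{t}[x]\le\mathfrak{w}[x]$ for all $x\in\mathfrak{X}$. The form $\mathfrak{t}$ is $\mathfrak{w}$-closable if for every sequence $(x_n)_{n\in\mathbb{N}}$ in $\mathfrak{X}$: whenever $\mathfrak{t}[x_n-x_m]\to 0$ as $n,m\to\infty$ and $\mathfrak{w}[x_n]\to 0$ as $n\to\infty$, then $\mathfrak{t}[x_n]\to 0$. The form $\mathfrak{t}$ is $\mathfrak{w}$-singular if for every form $\mathfrak{s}$ on $\mathfrak{X}$, $\mathfrak{s}\le\mathfrak{t}$ and $\mathfrak{s}\le\mathfrak{w}$ imply that $\mathfrak{s}$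 is the zero form. Let $\mathfrak{E}$ be a complex Banach space, $\mathfrak{E}^*$ its dual, and $\langle\cdot,\cdot\rangle:\mathfrak{E}\times\mathfrak{E}^*\to\mathbb{C}$ the duality, which is linear in its first and conjugate linear in its second variable (concretely, $\mathfrak{E}^*$ may be taken as the Banach space of bounded conjugate-linear functionals on $\mathfrak{E}$, with $\langle x,\varphi\rangle=\overline{\varphi(x)}$). Let $\mathbf{B}(\mathfrak{E},\mathfrak{E}^* )$ be the set of bounded linear operators from $\mathfrak{E}$ to $\mathfrak{E}^*$. Let $\mathfrak{X}$ be the complex linear space of all finitely supported functions $S\to\mathfrak{E}$. A function $\mathsf{K}:S\times S\to\mathbf{B}(\mathfrak{E},\mathfrak{E}^* )$ is a kernel (positive definite operator function) on $S$ if $$\mathfrak{w}_{\mathsf{K}}(f,g):=\sum_{s,t\in S}\big\langle f(t),\mathsf{K}(s,t)g(s)\big\rangle,\qquad f,g\in\mathfrak{X},$$ defines a form on $\mathfrak{X}$ (in particular $\mathfrak{w}_{\mathsf{K}}(f,f)\ge 0$ for all $f\in\mathfrak{X}$). For kernels $\mathsf{K},\mathsf{L}$ on $S$, $\mathsf{K}$ is $\mathsf{L}$-closable if $\mathfrak{w}_{\mathsf{K}}$ is $\mathfrak{w}_{\mathsf{L}}$-closable, and $\mathsf{K}$ is $\mathsf{L}$-singular if $\mathfrak{w}_{\mathsf{K}}$ is $\mathfrak{w}_{\mathsf{L}}$-singular. *)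

(* Defs.v *)
From HB Require Import structures.
From mathcomp Require Import all_boot all_order all_algebra.
From mathcomp Require Import complex.
From mathcomp Require Import all_classical all_reals all_analysis.

Set Implicit Arguments.
Unset Strict Implicit.
Unset Printing Implicit Defensive.

Import Order.TTheory GRing.Theory Num.Theory numFieldNormedType.Exports.

Local Open Scope classical_set_scope.
Local Open Scope ring_scope.

(* The instances of numFieldNormedType are keyed on structure projections and
   do not apply to the concrete type R[i]. *)
HB.instance Definition _ (R : realType) := NormedModule.copy R[i] R[i]^o.

(* On R[i], `0 <= z` means that z is real and nonnegative, and z^* = Num.conj z
   is definitionally the complex conjugate of z. *)
Section Forms.
Context {R : realType} {X : lmodType R[i]}.
Implicit Types t w s : X -> X -> R[i].

Definition is_form t :=
  [/\ forall y, linear_for *%R (t^~ y),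
      forall x, linear_for (Num.conj \; *%R) (t x)
    & forall x, 0 <= t x x].

Definition form_le t w := forall x, t x x <= w x x.

Definition form_closable t w := forall x_ : nat -> X,
  t (x_ nm.1 - x_ nm.2) (x_ nm.1 - x_ nm.2) @[nm --> (\oo, \oo)] --> 0 ->
  w (x_ n) (x_ n) @[n --> \oo] --> 0 ->
  t (x_ n) (x_ n) @[n --> \oo] --> 0.

Definition form_singular t w := forall s, is_form s ->
  form_le s t -> form_le s w -> forall x y, s x y = 0.

End Forms.

(* Boundedness of a (linear or conjugate linear) map between normed spaces. *)
Definition bounded_map {K : numFieldType} {V W : normedModType K}
  (f : V -> W) := exists M : K, forall x, `|f x| <= M * `|x|.

Section BoundedMapTheory.
Context {K : numFieldType} {V W : normedModType K}.
Implicit Types f g : V -> W.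

Lemma bounded_map0 : bounded_map (0 : V -> W).
Proof. by exists 0 => x; rewrite mul0r normr0. Qed.

Lemma bounded_mapDZ (a : K) f g :
  bounded_map f -> bounded_map g -> bounded_map (a *: f + g).
Proof.
move=> [M fM] [N gN]; exists (`|a| * M + N) => x.
rewrite (le_trans (ler_normD _ _))// mulrDl lerD// normrZ -mulrA.
by rewrite ler_wpM2l.
Qed.

End BoundedMapTheory.

Section BoundedLinear.
Context {K : numFieldType} (V W : normedModType K).

Definition bounded_linear_pred : {pred V -> W} :=
  mem [set f : V -> W | linear f /\ bounded_map f].

Lemma bounded_linear_submod : submod_closed bounded_linear_pred.
Proof.
split.
  apply/mem_set; split; last exact: bounded_map0.
  by move=> a x y; rewrite /= scaler0 addr0.
move=> a f g /set_mem[lf bf] /set_mem[lg bg]; apply/mem_set; split.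
  move=> b x y /=.
  rewrite !fctE lf lg !scalerDr !scalerA [a * b]mulrC -!addrA.
  by congr (_ + _); rewrite addrCA.
exact: bounded_mapDZ.
Qed.

HB.instance Definition _ := GRing.isSubmodClosed.Build _ _ bounded_linear_pred
  bounded_linear_submod.

Record bounded_linear := BoundedLinear {
  bounded_linear_fun :> V -> W;
  _ : bounded_linear_fun \in bounded_linear_pred }.

HB.instance Definition _ := [isSub for bounded_linear_fun].
HB.instance Definition _ := [Choice of bounded_linear by <:].
HB.instance Definition _ := [SubChoice_isSubLmodule of bounded_linear by <:].

End BoundedLinear.

Section Antidual.
Context {R : realType} (E : normedModType R[i]).

Definition antidual_pred : {pred E -> R[i]} :=
  mem [set f : E -> R[i] |
    linear_for (Num.conj \; *%R) f /\ bounded_map f].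

Lemma antidual_submod : submod_closed antidual_pred.
Proof.
split.
  apply/mem_set; split; last exact: bounded_map0.
  by move=> a x y; rewrite /= mulr0 addr0.
move=> a f g /set_mem[lf bf] /set_mem[lg bg]; apply/mem_set; split.
  move=> b x y; rewrite !fctE lf lg /= scalerDr mulrDr -!addrA.
  by congr (_ + _); [exact: mulrCA | rewrite addrCA].
exact: bounded_mapDZ.
Qed.

HB.instance Definition _ := GRing.isSubmodClosed.Build _ _ antidual_pred
  antidual_submod.

Record antidual := Antidual {
  antidual_fun :> E -> R[i];
  _ : antidual_fun \in antidual_pred }.

HB.instance Definition _ := [isSub for antidual_fun].
HB.instance Definition _ := [Choice of antidual by <:].
HB.instance Definition _ := [SubChoice_isSubLmodule of antidual by <:].

Implicit Types phi psi : antidual.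

Definition antidual_norm phi : R :=
  sup [set Normc.normc (phi x) | x in [set x | `|x| <= 1]].

Lemma antidual_linear phi : linear_for (Num.conj \; *%R) phi.
Proof. by case: phi => f /= /set_mem[]. Qed.

Lemma antidualZ phi a x : phi (a *: x) = a^* * phi x.
Proof.
have phi0 : phi 0 = 0.
  have := antidual_linear phi (-1) 0 0.
  by rewrite scaler0 addr0 /= rmorphN1 mulN1r addNr.
by have := antidual_linear phi a x 0; rewrite !addr0 phi0 addr0.
Qed.

Lemma antidualD phi x y : phi (x + y) = phi x + phi y.
Proof.
by have := antidual_linear phi 1 x y; rewrite scale1r /= rmorph1 mul1r.
Qed.

Lemma normc_le (z : R[i]) (M : R) : (Normc.normc z <= M) = (`|z| <= M%:C%C).
Proof. by rewrite -lecR. Qed.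

Lemma antidual_has_sup phi :
  has_sup [set Normc.normc (phi x) | x in [set x | `|x| <= 1]].
Proof.
split; first by exists (Normc.normc (phi 0)), 0 => //=; rewrite normr0 ler01.
case: phi => f /= /set_mem[_ [M fM]].
exists (Normc.normc M) => _ [x /= x1 <-].
rewrite normc_le; apply: le_trans (fM x) _.
have M0 : 0 <= M * `|x| by apply: le_trans (fM x); exact: normr_ge0.
apply: le_trans (real_ler_norm (ger0_real M0)) _.
by rewrite normrM normr_id; exact: ler_piMr.
Qed.

Lemma antidual_norm_ub phi x :
  `|x| <= 1 -> `|phi x| <= (antidual_norm phi)%:C%C.
Proof.
move=> x1; have := normc_le (phi x) (antidual_norm phi).
move=> <-; apply: sup_upper_bound; last by exists x.
exact: antidual_has_sup.
Qed.

Lemma antidual_norm_le phi (M : R) :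
  (forall x, `|x| <= 1 -> `|phi x| <= M%:C%C) -> antidual_norm phi <= M.
Proof.
move=> phiM; apply: ge_sup; first by case: (antidual_has_sup phi).
by move=> _ [x /= x1 <-]; rewrite normc_le; exact: phiM.
Qed.

Lemma antidual_norm_ge0 phi : 0 <= antidual_norm phi.
Proof.
rewrite -ler0c; apply: le_trans (antidual_norm_ub phi (x := 0) _).
  exact: normr_ge0.
by rewrite normr0 ler01.
Qed.

Lemma antidual_normP phi x : `|phi x| <= (antidual_norm phi)%:C%C * `|x|.
Proof.
have [->|x0] := eqVneq x 0.
  by rewrite -(scale0r 0) antidualZ rmorph0 mul0r scale0r !normr0 mulr0.
have nx0 : `|x| != 0 by rewrite normr_eq0.
rewrite -ler_pdivrMr ?normr_gt0//.
have : `|(`|x|^-1) *: x| <= 1 by rewrite normrZ normfV normr_id mulVf.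
move/(antidual_norm_ub phi); rewrite antidualZ normrM norm_conjC normfV normr_id.
by rewrite mulrC.
Qed.

Let norm phi : R[i] := (antidual_norm phi)%:C%C.

Let ler_normD phi psi : norm (phi + psi) <= norm phi + norm psi.
Proof.
rewrite /norm -raddfD lecR antidual_norm_le// => x x1.
by rewrite raddfD (le_trans (ler_normD _ _))// lerD// antidual_norm_ub.
Qed.

Let norm_leZ l phi : norm (l *: phi) <= `|l| * norm phi.
Proof.
have -> : `|l| * norm phi = (Normc.normc l * antidual_norm phi)%:C%C.
  by rewrite /norm rmorphM.
rewrite lecR; apply: antidual_norm_le => x x1.
rewrite [leRHS]rmorphM [leLHS]normrM.
by apply: ler_wpM2l; [exact: normr_ge0 | exact: antidual_norm_ub].
Qed.

Let normrZ l phi : norm (l *: phi) = `|l| * norm phi.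
Proof.
apply/eqP; rewrite eq_le norm_leZ /=.
have [->|l0] := eqVneq l 0.
  by rewrite normr0 mul0r ler0c antidual_norm_ge0.
rewrite -ler_pdivlMl ?normr_gt0// -normfV -{1}(scalerK l0 phi).
exact: norm_leZ.
Qed.

Let normr0_eq0 phi : norm phi = 0 -> phi = 0.
Proof.
move=> phi0; apply/val_inj/funext => x /=; apply/eqP.
by rewrite -normr_le0 (le_trans (antidual_normP phi x))// -/(norm phi) phi0 mul0r.
Qed.

HB.instance Definition _ :=
  Lmodule_isNormed.Build R[i] antidual ler_normD normrZ normr0_eq0.

Definition duality (x : E) phi : R[i] := (phi x)^*.

End Antidual.

Section FinitelySupported.
Context {K : nzRingType} (S : choiceType) (E : lmodType K).

Definition finsupp_pred : {pred S -> E} :=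
  mem [set f : S -> E | finite_set [set s | f s != 0]].

Lemma finsupp_submod : submod_closed finsupp_pred.
Proof.
split.
  apply/mem_set; rewrite /= (_ : [set _ | _] = set0)// -subset0 => s /=.
  by rewrite eqxx.
move=> a f g /set_mem ff /set_mem fg; apply/mem_set => /=.
apply: (@sub_finite_set _ _ ([set s | f s != 0] `|` [set s | g s != 0])).
  move=> s /=; rewrite !fctE; have [->|] := eqVneq (f s) 0; last by left.
  by rewrite scaler0 add0r; right.
by rewrite finite_setU.
Qed.

HB.instance Definition _ := GRing.isSubmodClosed.Build _ _ finsupp_pred
  finsupp_submod.

Record finsupp := Finsupp {
  finsupp_fun :> S -> E;
  _ : finsupp_fun \in finsupp_pred }.

HB.instance Definition _ := [isSub for finsupp_fun].
HB.instance Definition _ := [Choice of finsupp by <:].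
HB.instance Definition _ := [SubChoice_isSubLmodule of finsupp by <:].

End FinitelySupported.

Section Kernels.
Context {R : realType} {E : normedModType R[i]} {S : choiceType}.
Implicit Types K L : S -> S -> bounded_linear E (antidual E).

(* Both sums have finite support, since f and g do. *)
Definition kernel_form K (f g : finsupp S E) : R[i] :=
  \sum_(s \in [set: S]) \sum_(t \in [set: S]) duality (f t) (K s t (g s)).

Definition is_kernel K := is_form (kernel_form K).

Definition kernel_closable K L := form_closable (kernel_form K) (kernel_form L).

Definition kernel_singular K L := form_singular (kernel_form K) (kernel_form L).

End Kernels.

(* Main.v *)
From mathcomp Require Import finmap.
Require Import Defs.
From mathcomp Require Import all_boot all_order all_algebra.
From mathcomp Require Import complex.
From mathcomp Require Import all_classical all_reals all_analysis.
From mathcomp Require Import ring lra.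

(* For forms t and w, let d(x) be the lower limit of t[x - y] as w[y] tends to
   0. The parallelogram law for t at x - y and u - v, with w[y] and w[v] small,
   gives d(x + u) + d(x - u) <= 2 d(x) + 2 d(u), and the substitution
   (x, u) := (x + u, x - u) gives the converse. So, by Jordan and von Neumann,
   d is the diagonal of a form, and it is the w-closable part of t; the rest
   t - d is w-singular, since for w[y] small and t[x - y] close to d(x) also
   d(x - y) is close to d(x), so that (t - d)[x - y] is small.
   A form on finitely supported functions that lies below a kernel form is
   bounded on functions supported at a single point, hence is itself the form
   of a kernel. *)

Import Order.TTheory GRing.Theory Num.Theory numFieldNormedType.Exports.

Local Open Scope classical_set_scope.
Local Open Scope ring_scope.

(** * Forms, their diagonals and polarization *)

Section FormTheory.
Context {R : realType} {X : lmodType R[i]}.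
Implicit Types (t : X -> X -> R[i]) (q : X -> R).

Definition form_diag t (x : X) : R := complex.Re (t x x).

(** These conditions characterize the diagonals of forms: [form_quadratic] gives one direction,
    [polar_form] the other. The last factor is the squared modulus of [a], as an element of [R]. *)
Definition quadratic q :=
  [/\ forall x, 0 <= q x,
      forall x y, q (x + y) + q (x - y) = 2 * q x + 2 * q y
    & forall a x, q (a *: x) = (complex.Re a ^+ 2 + complex.Im a ^+ 2) * q x].

(** The polarization identity, split into real and imaginary part. Conjugate linearity in [y] fixes
    the sign of the imaginary part. *)
Definition polar q (x y : X) : R[i] :=
  (((q (x + y) - q (x - y)) / 4) +i*
   ((q (x + 'i%C *: y) - q (x - 'i%C *: y)) / 4))%C.

Lemma ReM (z w : R[i]) :
  complex.Re (z * w) = complex.Re z * complex.Re w - complex.Im z * complex.Im w.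
Proof. by case: z w => ? ? [? ?]. Qed.

Lemma ImM (z w : R[i]) :
  complex.Im (z * w) = complex.Re z * complex.Im w + complex.Im z * complex.Re w.
Proof. by case: z w => ? ? [? ?]. Qed.

Lemma ReD (z w : R[i]) : complex.Re (z + w) = complex.Re z + complex.Re w.
Proof. by case: z w => ? ? [? ?]. Qed.

Lemma ImD (z w : R[i]) : complex.Im (z + w) = complex.Im z + complex.Im w.
Proof. by case: z w => ? ? [? ?]. Qed.

Lemma ReN (z : R[i]) : complex.Re (- z) = - complex.Re z.
Proof. by case: z. Qed.

Lemma ImN (z : R[i]) : complex.Im (- z) = - complex.Im z.
Proof. by case: z. Qed.

Lemma Re_conj (z : R[i]) : complex.Re z^* = complex.Re z.
Proof. by case: z. Qed.

Lemma Im_conj (z : R[i]) : complex.Im z^* = - complex.Im z.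
Proof. by case: z. Qed.

Definition complex_partsE :=
  (ReM, ImM, ReD, ImD, ReN, ImN, Re_conj, Im_conj).

Lemma complex_ext (z w : R[i]) :
  complex.Re z = complex.Re w -> complex.Im z = complex.Im w -> z = w.
Proof. by case: z w => ? ? [? ?] /= -> ->. Qed.

Lemma form_diagE t x : is_form t -> t x x = (form_diag t x)%:C%C.
Proof.
case=> _ _ /(_ x) /ger0_Im; rewrite /form_diag.
by case: (t x x) => a b /= ->.
Qed.

Lemma is_formDl t x x' y : is_form t -> t (x + x') y = t x y + t x' y.
Proof. by case=> l _ _; have := l y 1 x x'; rewrite scale1r mul1r. Qed.

Lemma is_formDr t x y y' : is_form t -> t x (y + y') = t x y + t x y'.
Proof. by case=> _ l _; have := l x 1 y y'; rewrite scale1r /= rmorph1 mul1r. Qed.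

Lemma is_form0l t y : is_form t -> t 0 y = 0.
Proof. by move=> ft; apply: (addrI (t 0 y)); rewrite -is_formDl// !addr0. Qed.

Lemma is_form0r t x : is_form t -> t x 0 = 0.
Proof. by move=> ft; apply: (addrI (t x 0)); rewrite -is_formDr// !addr0. Qed.

Lemma is_formZl t a x y : is_form t -> t (a *: x) y = a * t x y.
Proof.
move=> ft; case: (ft) => l _ _; have := l y a x 0.
by rewrite addr0 is_form0l// addr0.
Qed.

Lemma is_formZr t a x y : is_form t -> t x (a *: y) = a^* * t x y.
Proof.
move=> ft; case: (ft) => _ l _; have := l x a y 0.
by rewrite addr0 is_form0r// addr0.
Qed.

Lemma is_formNl t x y : is_form t -> t (- x) y = - t x y.
Proof. by move=> ft; rewrite -scaleN1r is_formZl// mulN1r. Qed.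

Lemma is_formNr t x y : is_form t -> t x (- y) = - t x y.
Proof. by move=> ft; rewrite -scaleN1r is_formZr// rmorphN1 mulN1r. Qed.

Lemma is_form_suml t (I : Type) (r : seq I) (F : I -> X) y : is_form t ->
  t (\sum_(i <- r) F i) y = \sum_(i <- r) t (F i) y.
Proof.
move=> ft; apply: (big_morph (t^~ y)); last exact: is_form0l.
by move=> *; exact: is_formDl.
Qed.

Lemma is_form_sumr t (I : Type) (r : seq I) (F : I -> X) x : is_form t ->
  t x (\sum_(i <- r) F i) = \sum_(i <- r) t x (F i).
Proof.
move=> ft; apply: (big_morph (t x)); last exact: is_form0r.
by move=> *; exact: is_formDr.
Qed.

Lemma form_quadratic t : is_form t -> quadratic (form_diag t).
Proof.
move=> ft; split.
- by move=> x; case: (ft) => _ _ /(_ x); rewrite form_diagE// ler0c.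
- move=> x y; rewrite /form_diag !(is_formDl, is_formDr, is_formNl, is_formNr)//.
  by case: (t x x) (t x y) (t y x) (t y y) => [? ?] [? ?] [? ?] [? ?] /=; ring.
- move=> a x; rewrite /form_diag is_formZl// is_formZr// form_diagE//.
  rewrite !complex_partsE /=; ring.
Qed.

(** The diagonal is real: at [x + y] this makes the imaginary parts of [t x y] and [t y x] opposite,
    at [x + 'i y] it makes the real parts equal. *)
Lemma form_conj t x y : is_form t -> t y x = (t x y)^*.
Proof.
move=> ft; have im z : complex.Im (t z z) = 0 by rewrite form_diagE.
have := im (x + y); have := im (x + 'i%C *: y).
rewrite !(is_formDl, is_formDr, is_formZl, is_formZr)// !complex_partsE.
rewrite !im /= => h1 h2.
by apply: complex_ext; rewrite !complex_partsE /=; lra.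
Qed.

Lemma form_polar t : is_form t -> t = polar (form_diag t).
Proof.
move=> ft; apply/funext => x; apply/funext => y; rewrite /polar /form_diag.
by apply: complex_ext => /=;
  rewrite !(is_formDl, is_formDr, is_formNl, is_formNr, is_formZl,
    is_formZr)// (form_conj t x y)//;
  rewrite !complex_partsE /=; field.
Qed.

Lemma quadratic0 q : quadratic q -> q 0 = 0.
Proof.
case=> _ _ hZ; have := hZ 0 0; rewrite scale0r => ->.
by rewrite /= expr0n /= addr0 mul0r.
Qed.

Lemma quadraticN q x : quadratic q -> q (- x) = q x.
Proof.
case=> _ _ hZ; have := hZ (-1) x; rewrite scaleN1r => ->.
by rewrite /= oppr0 sqrrN expr1n expr0n addr0 mul1r.
Qed.

Lemma quadraticB q x y : quadratic q -> q (x - y) = q (y - x).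
Proof. by move=> hq; rewrite -quadraticN// opprB. Qed.

Lemma quadraticD_le q x y : quadratic q -> q (x + y) <= 2 * q x + 2 * q y.
Proof. by case=> q0 <- _; rewrite lerDl. Qed.

Lemma quadraticB_le q x y : quadratic q -> q (x - y) <= 2 * q x + 2 * q y.
Proof. by case=> q0 <- _; rewrite lerDr. Qed.

(** * Jordan-von Neumann *)

Section JordanVonNeumann.
Variables (q : X -> R) (hq : quadratic q).

(** Four times the real part of [polar q]. Real bilinearity comes first; the complex structure
    enters through [BZi]. *)
Let B (x y : X) : R := q (x + y) - q (x - y).

Let BC x y : B x y = B y x.
Proof. by rewrite /B (addrC x) (quadraticB q x y hq). Qed.

Let BNl x y : B (- x) y = - B x y.
Proof.
rewrite /B -opprD quadraticN// (addrC (- x)) (quadraticB q y x hq).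
by rewrite opprB.
Qed.

(** Add the parallelogram laws at [(x + y, z)] and [(x, y + z)], subtract the one at [(x - z, y)],
    and remove [q (x - z)] by the law at [(x, z)]. Additivity of [B] follows. *)
Let qD3 x y z :
  q (x + y + z) = q (x + y) + q (y + z) + q (x + z) - q x - q y - q z.
Proof.
case: hq => _ P _.
have P1 := P (x + y) z; have P2 := P (x - z) y; have P3 := P x (y + z).
have P4 := P x z.
have e1 : x - z + y = x + y - z by rewrite addrAC.
have e2 : x - z - y = x - (y + z) by rewrite opprD addrA addrAC.
rewrite e1 e2 in P2; rewrite addrA in P3.
lra.
Qed.

Let BDl x x' y : B (x + x') y = B x y + B x' y.
Proof. by rewrite /B !qD3 (quadraticN _ y)//; ring. Qed.

Let BMn x y n : B (x *+ n) y = B x y *+ n.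
Proof.
elim: n => [|n IHn]; last by rewrite !mulrS BDl IHn.
by rewrite !mulr0n /B add0r sub0r quadraticN// subrr.
Qed.

Let B_le h x y : `|h| <= 1 -> `|B (h%:C%C *: x) y| <= 2 * q x + 2 * q y.
Proof.
case: (hq) => q0 _ qZ h1; rewrite /B ler_norml.
have hx : q (h%:C%C *: x) <= q x.
  by rewrite qZ /= expr0n addr0 ler_piMl// -real_normK ?num_real// exprn_ile1.
have := quadraticD_le q (h%:C%C *: x) y hq.
have := quadraticB_le q (h%:C%C *: x) y hq.
have := q0 (h%:C%C *: x + y); have := q0 (h%:C%C *: x - y).
by move=> *; apply/andP; split; lra.
Qed.

(* An additive function of a real variable that is bounded on [-1, 1] is
   linear; boundedness here comes from [B_le]. *)
Let BZ_ge0 a x y : 0 <= a -> B (a%:C%C *: x) y = a * B x y.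
Proof.
move=> a0; apply/eqP; rewrite -subr_eq0 -normr_le0.
set c := 2 * q x + 2 * q y + `|B x y|.
apply/ler_addgt0Pl => e e0; rewrite addr0.
(* Write [n a = k + h] with [k] a natural number and [0 <= h < 1]. By additivity [n] times the
   defect from homogeneity at [a] is the defect at [h], which is at most [c]; this [n] makes
   [c < n e]. *)
pose n := (Num.trunc (c / e)).+1.
have n0 : 0 < n%:R :> R by rewrite ltr0n.
rewrite -(ler_pM2l n0).
have ce : c < n%:R * e by rewrite -ltr_pdivrMr// truncnS_gt.
apply: le_trans (ltW ce).
pose k := Num.trunc (n%:R * a); pose h := n%:R * a - k%:R.
have na0 : 0 <= n%:R * a by rewrite mulr_ge0// ltW.
have /andP[kl ku] := truncn_itv na0.
have h1 : `|h| <= 1.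
  by rewrite /h ger0_norm ?subr_ge0// lerBlDl natr1 ltW.
have -> : n%:R * `|B (a%:C%C *: x) y - a * B x y| =
    `|B (h%:C%C *: x) y - h * B x y|.
  rewrite -[in LHS](ger0_norm (ltW n0)) -normrM mulrBr; congr `|_|.
  have -> : n%:R * B (a%:C%C *: x) y = B (h%:C%C *: x) y + k%:R * B x y.
    rewrite !mulr_natl -!BMn -BDl; congr (B _ y).
    rewrite -[_ *+ n]scaler_nat -[x *+ k]scaler_nat scalerA -scalerDl.
    congr (_ *: _).
    by rewrite /h rmorphB rmorphM !rmorph_nat subrK.
  by rewrite /h; ring.
rewrite (le_trans (ler_normB _ _))// lerD ?B_le//.
by rewrite normrM ler_piMl.
Qed.

Let BZ a x y : B (a%:C%C *: x) y = a * B x y.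
Proof.
have [a0|/ltW a0] := leP 0 a; first exact: BZ_ge0.
rewrite -[a]opprK rmorphN scaleNr BNl BZ_ge0 ?oppr_ge0//.
by rewrite !mulNr.
Qed.

Let BZii x y : B ('i%C *: x) ('i%C *: y) = B x y.
Proof.
case: hq => _ _ qZ.
by rewrite /B -scalerBr -scalerDr !qZ /= expr0n expr1n add0r !mul1r.
Qed.

Let BZi x y : B ('i%C *: x) y = - B x ('i%C *: y).
Proof.
rewrite -BZii scalerA (_ : 'i%C * 'i%C = -1) ?scaleN1r ?BNl//.
by rewrite -expr2 sqr_i.
Qed.

Lemma polar_diag x : polar q x x = (q x)%:C%C.
Proof.
case: (hq) => _ _ qZ; rewrite /polar.
have -> : q (x + x) = 4 * q x.
  by rewrite -mulr2n -scaler_nat qZ; congr (_ * _) => /=; ring.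
(* Both [1 + 'i] and [1 - 'i] have squared modulus 2, so the imaginary part cancels. *)
have -> : q (x + 'i%C *: x) = 2 * q x.
  by rewrite -[X in X + _]scale1r -scalerDl qZ; congr (_ * _) => /=; ring.
have -> : q (x - 'i%C *: x) = 2 * q x.
  by rewrite -[X in X - _]scale1r -scalerBl qZ; congr (_ * _) => /=; ring.
by rewrite !subrr quadratic0//; apply: complex_ext => /=; field.
Qed.

Let polarC x y : polar q y x = (polar q x y)^*.
Proof.
apply: complex_ext; rewrite !complex_partsE /= -!/(B _ _) ?[B y x]BC//.
by rewrite BC BZi mulNr.
Qed.

Let polar_linl y : linear_for *%R (polar q ^~ y).
Proof.
move=> a u v; have BZc z : B (a *: u) z =
    complex.Re a * B u z - complex.Im a * B u ('i%C *: z).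
  by rewrite {1}[a]complexE scalerDl BDl BZ -scalerA BZi BZ.
apply: complex_ext; rewrite !complex_partsE /= -!/(B _ _) !BDl !BZc.
  by field.
rewrite -[B u ('i%C *: ('i%C *: y))]opprK -BZi BZii.
by field.
Qed.

Lemma polar_form : is_form (polar q).
Proof.
split; first exact: polar_linl.
  move=> x a u v; rewrite polarC polar_linl rmorphD rmorphM.
  by rewrite /= -!polarC.
by move=> x; rewrite polar_diag ler0c; case: (hq).
Qed.

End JordanVonNeumann.
End FormTheory.

(** * The closable part of a quadratic functional *)

Section RegularPart.
Context {R : realType} {X : lmodType R[i]}.
Variables (T W : X -> R) (hT : quadratic T) (hW : quadratic W).

(** The levels [c] at or above the lower limit; one tolerance [e] controls both [W y] and the excess
    over [c]. Taking [y = 0] shows that [T x] is such a level. *)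
Let upper (x : X) : set R :=
  [set c | forall e, 0 < e -> exists y, W y < e /\ T (x - y) < c + e].

(* The lower limit of [T (x - y)] as [W y] tends to 0. *)
Definition regular_part (x : X) : R := inf (upper x).

Let upperT x : upper x (T x).
Proof.
move=> e e0; exists 0; rewrite subr0 quadratic0//.
by split=> //; rewrite ltrDl.
Qed.

Let upper_ge0 x c : upper x c -> 0 <= c.
Proof.
move=> ux; apply/ler_addgt0Pr => e /ux[y [_ /ltW]].
by apply: le_trans; case: hT.
Qed.

Let upper_has_inf x : has_inf (upper x).
Proof. by split; [exists (T x)|exists 0 => c /upper_ge0]. Qed.

Lemma regular_part_ge0 x : 0 <= regular_part x.
Proof. by apply: lb_le_inf; [exists (T x)|move=> c /upper_ge0]. Qed.

Lemma regular_part_le_bound x c :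
  (forall e, 0 < e -> exists y, W y < e /\ T (x - y) < c + e) ->
  regular_part x <= c.
Proof. by move=> ux; apply: ge_inf => //; case: (upper_has_inf x). Qed.

Lemma regular_part_le x : regular_part x <= T x.
Proof. exact: regular_part_le_bound (upperT x). Qed.

Lemma regular_part_approx x e : 0 < e ->
  exists y, W y < e /\ T (x - y) < regular_part x + e.
Proof.
move=> e0; have e20 : 0 < e / 2 by rewrite divr_gt0.
have [c uc clt] := inf_adherent e20 (upper_has_inf x).
have [y [Wy Ty]] := uc _ e20; exists y; split; first by lra.
by rewrite -/(regular_part x) in clt; lra.
Qed.

(** If no [d] worked, [regular_part x - e] would itself belong to [upper x], below its infimum. *)
Lemma regular_part_lower x e : 0 < e ->
  exists2 d, 0 < d & forall y, W y < d -> regular_part x - e < T (x - y).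
Proof.
move=> e0; apply: contrapT => h.
suff /regular_part_le_bound : upper x (regular_part x - e) by lra.
move=> d d0; apply: contrapT => hd; apply: h; exists d => // y Wy.
rewrite ltNge; apply/negP => Ty; apply: hd; exists y; split => //.
by rewrite (le_lt_trans Ty)// ltrDl.
Qed.

Let regular_part_parallelogram_le x u :
  regular_part (x + u) + regular_part (x - u) <=
  2 * regular_part x + 2 * regular_part u.
Proof.
apply/ler_addgt0Pl => e e0.
have e60 : 0 < e / 6 by rewrite divr_gt0.
have [a a0 ha] := regular_part_lower (x + u) _ e60.
have [b b0 hb] := regular_part_lower (x - u) _ e60.
(* [W (y + v)] and [W (y - v)] stay below [4 d], hence below [a] and [b]. The errors are [e / 6]
   from each lower bound and [2 d] from each approximant, at most [e] together. *)
pose d := Num.min (e / 6) (Num.min (a / 4) (b / 4)).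
have d0 : 0 < d by rewrite !lt_min e60 !divr_gt0.
have [y [Wy Ty]] := regular_part_approx x _ d0.
have [v [Wv Tv]] := regular_part_approx u _ d0.
have [de da db] : [/\ d <= e / 6, d <= a / 4 & d <= b / 4].
  by rewrite /d !ge_min !lexx !orbT.
have WD := quadraticD_le W y v hW; have WB := quadraticB_le W y v hW.
have Ha : regular_part (x + u) - e / 6 < T (x + u - (y + v)).
  by apply: ha; lra.
have Hb : regular_part (x - u) - e / 6 < T (x - u - (y - v)).
  by apply: hb; lra.
have P : T (x + u - (y + v)) + T (x - u - (y - v)) =
    2 * T (x - y) + 2 * T (u - v).
  case: hT => _ <- _; congr (T _ + T _); first by rewrite opprD addrACA.
  by rewrite !opprB addrACA [RHS]addrACA [- u - y]addrC.
lra.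
Qed.

(** Replacing [y] by [a *: y] multiplies [W y] and [T (x - y)] by the same factor, so an approximant
    for [x] becomes one for [a *: x]. *)
Let regular_partZ_le a x : a != 0 ->
  regular_part (a *: x) <=
  (complex.Re a ^+ 2 + complex.Im a ^+ 2) * regular_part x.
Proof.
move=> a0; set n := complex.Re a ^+ 2 + complex.Im a ^+ 2.
have n0 : 0 < n.
  rewrite lt_neqAle addr_ge0 ?sqr_ge0// andbT eq_sym.
  apply: contra a0; rewrite paddr_eq0 ?sqr_ge0// !sqrf_eq0 => /andP[/eqP r /eqP i].
  by apply/eqP/complex_ext.
apply: regular_part_le_bound => e e0.
have [y [Wy Ty]] := regular_part_approx x _ (divr_gt0 e0 n0).
exists (a *: y); case: hT hW => _ _ TZ [_ _ WZ].
rewrite -scalerBr TZ WZ -/n; split.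
  by rewrite mulrC -ltr_pdivlMr.
by rewrite -ltr_pdivlMl// mulrDr mulKf ?gt_eqF// [_^-1 * e]mulrC.
Qed.

Lemma regular_part_quadratic : quadratic regular_part.
Proof.
have Z a x : regular_part (a *: x) =
    (complex.Re a ^+ 2 + complex.Im a ^+ 2) * regular_part x.
  have [->|a0] := eqVneq a 0.
    rewrite scale0r /= expr0n/= addr0 mul0r.
    apply/eqP; rewrite eq_le regular_part_ge0 andbT.
    by rewrite (le_trans (regular_part_le _))// quadratic0.
  apply/eqP; rewrite eq_le regular_partZ_le//=.
  (* The reverse inequality is the bound for [a^-1] at the point [a *: x]. *)
  have := regular_partZ_le a^-1 (a *: x); rewrite invr_eq0 => /(_ a0).
  rewrite scalerA mulVf// scale1r.
  set m := _ + _; set n := _ + _ => h.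
  have nm : m * n = 1.
    have := mulVf a0 => /(congr1 (fun z : R[i] => complex.Re (z * z^*))).
    by rewrite !complex_partsE [complex.Re 1]/= [complex.Im 1]/= /m /n; lra.
  have m0 : 0 <= m by rewrite addr_ge0 ?sqr_ge0.
  have n0 : 0 <= n by rewrite addr_ge0 ?sqr_ge0.
  apply: le_trans (ler_wpM2l n0 h) _.
  by rewrite mulrA [n * m]mulrC nm mul1r.
split; [exact: regular_part_ge0| |exact: Z].
move=> x y; apply/eqP; rewrite eq_le regular_part_parallelogram_le /=.
have := regular_part_parallelogram_le (x + y) (x - y).
have -> : x + y + (x - y) = 2 *: x by rewrite addrACA subrr addr0 scaler_nat.
have -> : x + y - (x - y) = 2 *: y by rewrite opprB addrC addrA subrK scaler_nat.
by rewrite !Z /= !addr0 expr0n /=; lra.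
Qed.

(** Fix a large [n]. For [m] large [W (x_ m)] is small, so an approximant [y] of [x_ n - x_ m] gives
    the approximant [x_ m + y] of [x_ n] with the same value of [T]. *)
Lemma regular_part_closable (x_ : nat -> X) :
  (forall e, 0 < e -> exists N, forall n m, (N <= n)%N -> (N <= m)%N ->
    regular_part (x_ n - x_ m) < e) ->
  (forall e, 0 < e -> exists N, forall n, (N <= n)%N -> W (x_ n) < e) ->
  forall e, 0 < e -> exists N, forall n, (N <= n)%N -> regular_part (x_ n) < e.
Proof.
move=> cx wx e e0; have e20 : 0 < e / 2 by rewrite divr_gt0.
have [N hN] := cx _ e20; exists N => n nN.
suff : regular_part (x_ n) <= e / 2 by lra.
apply: regular_part_le_bound => d d0; have d40 : 0 < d / 4 by rewrite divr_gt0.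
have [M hM] := wx _ d40; pose m := maxn N M.
have Wm : W (x_ m) < d / 4 by apply: hM; exact: leq_maxr.
have dm : regular_part (x_ n - x_ m) < e / 2 by apply: hN => //; exact: leq_maxl.
have [y [Wy Ty]] := regular_part_approx (x_ n - x_ m) _ d40.
exists (x_ m + y); have := quadraticD_le W (x_ m) y hW.
by rewrite opprD addrA => *; split; lra.
Qed.

Lemma regular_part_singular (q : X -> R) : quadratic q ->
  (forall x, q x <= T x - regular_part x) -> (forall x, q x <= W x) ->
  forall x, q x = 0.
Proof.
move=> hq qT qW x; apply/eqP; rewrite eq_le; case: (hq) => -> _ _.
rewrite andbT; apply/ler_addgt0Pl => e e0; rewrite addr0.
have e80 : 0 < e / 8 by rewrite divr_gt0.
have [a a0 ha] := regular_part_lower x _ e80.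
pose d := Num.min (e / 8) (a / 4).
have d0 : 0 < d by rewrite lt_min e80 divr_gt0.
have [de da] : d <= e / 8 /\ d <= a / 4 by rewrite /d !ge_min !lexx !orbT.
have [y [Wy Ty]] := regular_part_approx x _ d0.
(* This [z] bounds [regular_part (x - y)] from below: [W (y + z) < 4 d <= a], so [T (x - y - z)]
   exceeds [regular_part x - e / 8]. *)
have [z [Wz Tz]] := regular_part_approx (x - y) _ d0.
have Wyz := quadraticD_le W y z hW.
have : regular_part x - e / 8 < T (x - (y + z)) by apply: ha; lra.
rewrite opprD addrA => Hx.
(* Now [q (x - y) < 3 e / 8] and [q y < e / 8], hence [q x < e]. *)
have := quadraticD_le q (x - y) y hq; rewrite subrK.
by have := qT (x - y); have := qW y; lra.
Qed.

End RegularPart.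

(** * Lebesgue decomposition of forms *)

Section Decomposition.
Context {R : realType} {X : lmodType R[i]}.
Implicit Types t w : X -> X -> R[i].

Lemma normc_realE (r : R) : `|r%:C%C| = `|r|%:C%C :> R[i].
Proof. by rewrite normc_def /= expr0n /= addr0 sqrtr_sqr. Qed.

Lemma cvg_real_complex0P (u : nat -> R) :
  (u n)%:C%C @[n --> \oo] --> (0 : R[i]) <->
  forall e, 0 < e -> exists N, forall n, (N <= n)%N -> `|u n| < e.
Proof.
split.
  move/cvgr0Pnorm_lt => h e e0; have /h : 0 < e%:C%C by rewrite ltcR.
  move=> [N _ hN]; exists N => n nN.
  by have := hN n nN; rewrite /= normc_realE ltcR.
move=> h; apply/cvgr0Pnorm_lt => e e0.
(* Positivity in [R[i]] forces [e] to be real. *)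
have [e_real re0] : e = (complex.Re e)%:C%C /\ 0 < complex.Re e.
  move: e0; rewrite ltcE /= => /andP[/eqP e1 e2]; split => //.
  by apply: complex_ext.
have [N hN] := h _ re0; exists N => // n nN /=.
by rewrite normc_realE e_real ltcR; exact: hN.
Qed.

Lemma cvg_real_complex0_pair (u : nat * nat -> R) :
  (u nm)%:C%C @[nm --> (\oo, \oo)] --> (0 : R[i]) ->
  forall e, 0 < e -> exists N, forall n m, (N <= n)%N -> (N <= m)%N ->
    `|u (n, m)| < e.
Proof.
move/cvgr0Pnorm_lt => h e e0; have /h : 0 < e%:C%C by rewrite ltcR.
move=> [[A B] /= [[N _ hN] [M _ hM]] AB]; exists (maxn N M) => n m nN mN.
have /AB : (A `*` B) (n, m).
  by split; [apply: hN|apply: hM] => /=; apply: leq_trans (_ : _ <= maxn N M)%N _;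
    rewrite ?leq_maxl ?leq_maxr.
by rewrite /= normc_realE ltcR.
Qed.

Lemma form_closable_diag t w : is_form t -> is_form w ->
  (forall x_ : nat -> X,
    (forall e, 0 < e -> exists N, forall n m, (N <= n)%N -> (N <= m)%N ->
      form_diag t (x_ n - x_ m) < e) ->
    (forall e, 0 < e -> exists N, forall n, (N <= n)%N ->
      form_diag w (x_ n) < e) ->
    forall e, 0 < e -> exists N, forall n, (N <= n)%N ->
      form_diag t (x_ n) < e) ->
  form_closable t w.
Proof.
move=> ft fw h x_ ct cw.
have [t0 _ _] := form_quadratic t ft; have [w0 _ _] := form_quadratic w fw.
have E s (y_ : nat -> X) : is_form s ->
    (fun n => s (y_ n) (y_ n)) = (fun n => (form_diag s (y_ n))%:C%C).
  by move=> fs; apply/funext => n; rewrite form_diagE.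
have E2 : (fun nm : nat * nat => t (x_ nm.1 - x_ nm.2) (x_ nm.1 - x_ nm.2)) =
    (fun nm => (form_diag t (x_ nm.1 - x_ nm.2))%:C%C).
  by apply/funext => n; rewrite form_diagE.
rewrite E2 in ct; rewrite E// in cw; rewrite E//.
apply/cvg_real_complex0P => e e0.
have [||N hN] := h x_ _ _ e e0.
- move=> d d0; have [N hN] := cvg_real_complex0_pair _ ct d d0.
  by exists N => n m nN mN; have := hN n m nN mN; rewrite ger0_norm.
- move=> d d0; have [N hN] := (cvg_real_complex0P _).1 cw d d0.
  by exists N => n nN; have := hN n nN; rewrite ger0_norm.
- by exists N => n nN; rewrite ger0_norm// hN.
Qed.

(** A coarse substitute for Cauchy-Schwarz, from polarization and the parallelogram law. It makes a
    form with zero diagonal vanish and bounds the entries in [kernel_of_form]. *)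
Lemma form_bound t x y : is_form t ->
  `|t x y| <= (2 * form_diag t x + 2 * form_diag t y)%:C%C.
Proof.
move=> ft; have hq := form_quadratic t ft; have [q0 qD qZ] := hq.
rewrite [in leLHS](form_polar t ft) /polar.
have bound z : `|(form_diag t (x + z) - form_diag t (x - z)) / 4| <=
    (form_diag t x + form_diag t z) / 2.
  have := qD x z; have := q0 (x + z); have := q0 (x - z).
  by rewrite ler_norml; move=> *; apply/andP; split; lra.
have := bound y; have := bound ('i%C *: y).
rewrite qZ /= expr0n expr1n add0r mul1r => b1 b2.
set z := (_ +i* _)%C; rewrite [z]complexE (le_trans (ler_normD _ _))//.
rewrite normrM !normc_realE normc_def /= expr0n expr1n add0r sqrtr1 mul1r.
rewrite -rmorphD lecR /z /=; have := q0 x; have := q0 y; lra.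
Qed.

Lemma form_decomposition t w : is_form t -> is_form w ->
  exists tr ts, [/\ is_form tr, is_form ts,
    forall x y, t x y = tr x y + ts x y,
    form_closable tr w & form_singular ts w].
Proof.
move=> ft fw.
have qt := form_quadratic t ft; have qw := form_quadratic w fw.
pose d := regular_part (form_diag t) (form_diag w).
have qd : quadratic d by exact: regular_part_quadratic.
have fr : is_form (polar d) by exact: polar_form.
have dE : form_diag (polar d) = d.
  by apply/funext => x; rewrite /form_diag polar_diag.
exists (polar d), (fun x y => t x y - polar d x y).
have fs : is_form (fun x y => t x y - polar d x y).
  split.
  - move=> y a u v; rewrite /= !(is_formDl t, is_formZl t)//.
    rewrite !(is_formDl (polar d), is_formZl (polar d))//.
    by ring.
  - move=> x a u v; rewrite /= !(is_formDr t, is_formZr t)//.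
    rewrite !(is_formDr (polar d), is_formZr (polar d))//=.
    by ring.
  - move=> x; rewrite polar_diag// form_diagE// -rmorphB ler0c subr_ge0.
    exact: regular_part_le.
have fsE x : form_diag (fun x y => t x y - polar d x y) x = form_diag t x - d x.
  by rewrite {1}/form_diag polar_diag// form_diagE.
split => //.
- by move=> x y; rewrite addrC subrK.
- apply: form_closable_diag => // x_; rewrite dE.
  exact: regular_part_closable.
- move=> s hs ss sw x y.
  have s0 z : form_diag s z = 0.
    apply: (regular_part_singular _ _ qt qw _ (form_quadratic s hs)) => u.
      by rewrite -fsE -lecR -!form_diagE//; exact: ss.
    by rewrite -lecR -!form_diagE//; exact: sw.
  apply/eqP; rewrite -normr_le0 (le_trans (form_bound _ _ _ hs))//.
  by rewrite !s0 mulr0 addr0.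
Qed.

End Decomposition.

(** * Forms of kernels *)

Section KernelForms.
Context {R : realType} {E : normedModType R[i]} {S : choiceType}.
Implicit Types K : S -> S -> bounded_linear E (antidual E).

Lemma delta_finsupp (s : S) (e : E) :
  (fun t => if t == s then e else 0) \in @finsupp_pred R[i] S E.
Proof.
apply/mem_set; apply: (@sub_finite_set _ _ [set s]) => //= t.
by rewrite /=; case: (t =P s) => // _; rewrite eqxx.
Qed.

Definition delta s e : finsupp S E := Finsupp (delta_finsupp s e).

Lemma deltaDZ s a e e' : delta s (a *: e + e') = a *: delta s e + delta s e'.
Proof.
apply/val_inj/funext => t /=; rewrite !fctE /=.
by case: (t =P s) => // _; rewrite scaler0 addr0.
Qed.

Lemma deltaZ s a e : delta s (a *: e) = a *: delta s e.
Proof.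
apply/val_inj/funext => t /=; rewrite !fctE /=.
by case: (t =P s) => // _; rewrite scaler0.
Qed.

Definition support (f : finsupp S E) : {fset S} :=
  fset_set [set s | f s != 0].

Lemma notin_support (f : finsupp S E) s : s \notin support f -> f s = 0.
Proof.
rewrite in_fset_set; last by case: f => f /= /set_mem.
by move=> h; apply/eqP; apply: contraNT h => h; apply/mem_set.
Qed.

Lemma finsupp_sum (f : finsupp S E) :
  f = \sum_(s <- support f) delta s (f s).
Proof.
apply/val_inj/funext => t; set F := fun s => delta s (f s).
rewrite [RHS](big_morph (fun h : finsupp S E => h t) (id1 := 0) (op1 := +%R))//.
rewrite /F /=.
have [tf|/[dup] tf /notin_support ft0] := boolP (t \in support f).
  rewrite (bigD1_seq t)//= eqxx big1 ?addr0// => s /negbTE.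
  by rewrite eq_sym => ->.
rewrite [LHS]ft0 big_seq big1// => s sf; case: eqP => // ts.
by rewrite -ts (negbTE tf) in sf.
Qed.

Lemma bounded_linear0 {K : numFieldType} {V W : normedModType K}
  (f : bounded_linear V W) : f 0 = 0.
Proof.
case: f => f /= /set_mem[lf _]; have := lf (-1) 0 0.
by rewrite scaler0 addr0 scaleN1r addNr.
Qed.

Lemma antidual0 (phi : antidual E) : phi 0 = 0.
Proof. by rewrite -(scale0r 0) antidualZ rmorph0 mul0r. Qed.

Lemma dualityl0 (phi : antidual E) : duality 0 phi = 0.
Proof. by rewrite /duality antidual0 rmorph0. Qed.

Lemma dualityr0 (x : E) : duality x (0 : antidual E) = 0.
Proof. by rewrite /duality rmorph0. Qed.

Lemma kernel_form_support K (f g : finsupp S E) :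
  kernel_form K f g =
  \sum_(s <- support g) \sum_(t <- support f) duality (f t) (K s t (g s)).
Proof.
rewrite /kernel_form (fsbigTE (support g)).
  apply: eq_bigr => s _; apply: fsbigTE => t /notin_support ->.
  exact: dualityl0.
move=> s /notin_support ->; apply: fsbig1 => t _.
by rewrite bounded_linear0 dualityr0.
Qed.

(** The form determines the entries of its kernel; this gives uniqueness in [kernel_ext] and
    dictates the entries in [kernel_of_form]. *)
Lemma kernel_form_delta K s t e e' :
  kernel_form K (delta t e') (delta s e) = duality e' (K s t e).
Proof.
rewrite /kernel_form (fsbigTE ([fset s]%fset)).
  rewrite big_seq_fset1 /= eqxx (fsbigTE ([fset t]%fset)).
    by rewrite big_seq_fset1 /= eqxx.
  by move=> i; rewrite inE /= => /negbTE ->; rewrite dualityl0.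
move=> i; rewrite inE /= => /negbTE ->; apply: fsbig1 => j _.
by rewrite bounded_linear0 dualityr0.
Qed.

Lemma kernel_ext K K' :
  (forall f g, kernel_form K f g = kernel_form K' f g) ->
  forall s t, K s t = K' s t.
Proof.
move=> h s t; apply/val_inj/funext => e; apply/val_inj/funext => e' /=.
have := h (delta t e') (delta s e); rewrite !kernel_form_delta.
exact: (can_inj conjCK).
Qed.

Lemma kernel_formD K K' f g :
  kernel_form (fun s t => K s t + K' s t) f g =
  kernel_form K f g + kernel_form K' f g.
Proof.
rewrite !kernel_form_support -big_split /=; apply: eq_bigr => s _.
rewrite -big_split /=; apply: eq_bigr => t _.
by rewrite /duality -rmorphD.
Qed.

(** Absolute homogeneity covers linear and conjugate linear maps alike. *)
Lemma bounded_map_unit_ball {V W : normedModType R[i]} (f : V -> W) (M : R[i]) :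
  (forall a x, `|f (a *: x)| = `|a| * `|f x|) ->
  (forall x, `|x| <= 1 -> `|f x| <= M) -> forall x, `|f x| <= M * `|x|.
Proof.
move=> fZ fM x; have [->|x0] := eqVneq x 0.
  by rewrite -(scale0r 0) fZ scale0r !normr0 mul0r mulr0.
have nx : 0 < `|x| by rewrite normr_gt0.
rewrite -ler_pdivrMr// mulrC.
have := fM (`|x|^-1 *: x); rewrite fZ normrZ normfV normr_id mulVf ?gt_eqF//.
exact.
Qed.

(** * The kernel of a form dominated by a kernel form *)

Section KernelOfForm.
Variables (t : finsupp S E -> finsupp S E -> R[i])
  (K : S -> S -> bounded_linear E (antidual E)).
Hypotheses (ft : is_form t) (hK : is_kernel K)
  (tK : form_le t (kernel_form K)).

Let diag_bound s : exists M : R, forall e, `|e| <= 1 ->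
  form_diag t (delta s e) <= M.
Proof.
have [M hM] : bounded_map (K s s) by case: (K s s) => f /= /set_mem[].
(* The constant [M] lives in [R[i]]; its modulus is a real bound, because [M] times the norm of [e]
   is real and nonnegative. *)
exists (complex.Re `|M|) => e e1; rewrite -lecR -form_diagE//.
have -> : (complex.Re `|M|)%:C%C = `|M| by rewrite normc_def.
apply: le_trans (tK _) _; rewrite kernel_form_delta.
have [_ _ K0] := hK; have := K0 (delta s e); rewrite kernel_form_delta.
move=> /ger0_norm <-; rewrite /duality norm_conjC.
apply: le_trans (antidual_normP _ _) _.
apply: le_trans (ler_piMr _ e1) _; first exact: normr_ge0 (K s s e).
apply: le_trans (hM e) _.
have M0 : 0 <= M * `|e| by apply: le_trans (hM e); exact: normr_ge0.
apply: le_trans (real_ler_norm (ger0_real M0)) _.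
by rewrite normrM normr_id; exact: ler_piMr.
Qed.

Lemma kernel_of_form : exists T : S -> S -> bounded_linear E (antidual E),
  forall f g, kernel_form T f g = t f g.
Proof.
have [M hM] := choice diag_bound.
(* The conjugation undoes the one in [duality], and makes [phi] linear in [e] and conjugate linear
   in [e']. *)
pose phi s u (e : E) (e' : E) : R[i] := (t (delta u e') (delta s e))^*.
have phiM s u e e' : `|e| <= 1 -> `|e'| <= 1 ->
    `|phi s u e e'| <= (2 * M u + 2 * M s)%:C%C.
  move=> e1 e'1; rewrite /phi norm_conjC (le_trans (form_bound _ _ _ ft))//.
  by rewrite lecR lerD// ler_wpM2l// hM.
have phiZl s u a e e' : phi s u (a *: e) e' = a * phi s u e e'.
  by rewrite /phi deltaZ is_formZr// rmorphM; congr (_ * _); exact: conjCK.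
have phiZr s u a e e' : phi s u e (a *: e') = a^* * phi s u e e'.
  by rewrite /phi deltaZ is_formZl// rmorphM.
have phi_pred s u e : phi s u e \in @antidual_pred R E.
  apply/mem_set; split.
    move=> a x y; rewrite /phi deltaDZ is_formDl// is_formZl//.
    by rewrite rmorphD rmorphM.
  (* The bound [phiM] on unit balls is rescaled in each variable separately. *)
  exists ((2 * M u + 2 * M s)%:C%C * `|e|).
  apply: bounded_map_unit_ball => [a x|x x1].
    by rewrite phiZr normrM norm_conjC.
  apply: (bounded_map_unit_ball (fun e => phi s u e x)) => [a y|y y1].
    by rewrite phiZl normrM.
  exact: phiM.
pose Phi s u e := Antidual (phi_pred s u e).
have Phi_pred s u : Phi s u \in @bounded_linear_pred R[i] E (antidual E).
  apply/mem_set; split.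
    move=> a x y; apply/val_inj/funext => e' /=; rewrite !fctE /=.
    rewrite /phi deltaDZ is_formDr// is_formZr// rmorphD rmorphM.
    by congr (_ * _ + _); exact: conjCK.
  exists (2 * M u + 2 * M s)%:C%C.
  apply: bounded_map_unit_ball => [a x|x x1]; last first.
    by rewrite lecR; apply: antidual_norm_le => e' e'1; exact: phiM.
  rewrite -normrZ; congr (`|_|); apply/val_inj/funext => e' /=.
  exact: phiZl.
exists (fun s u => BoundedLinear (Phi_pred s u)) => f g.
rewrite kernel_form_support.
rewrite [in RHS](finsupp_sum f) [in RHS](finsupp_sum g) is_form_sumr//.
apply: eq_bigr => s _; rewrite is_form_suml//; apply: eq_bigr => u _.
exact: conjCK.
Qed.

End KernelOfForm.
End KernelForms.

Theorem theorem4p3 (R : realType) (E : completeNormedModType R[i])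
    (S : choiceType) (K L : S -> S -> bounded_linear E (antidual E)) :
  [set: S] !=set0 -> is_kernel K -> is_kernel L ->
  exists Kr Ks : S -> S -> bounded_linear E (antidual E),
    [/\ is_kernel Kr, is_kernel Ks,
        forall s t, K s t = Kr s t + Ks s t,
        kernel_closable Kr L & kernel_singular Ks L].
Proof.
move=> _ hK hL.
have [tr [ts [fr fs KE cr ss]]] := form_decomposition _ _ hK hL.
(* Each part lies below the form of [K] because the other is nonnegative on the diagonal. *)
have rK : form_le tr (kernel_form K).
  by move=> f; rewrite KE lerDl; case: fs.
have sK : form_le ts (kernel_form K).
  by move=> f; rewrite KE lerDr; case: fr.
have [Kr KrE] := kernel_of_form _ _ fr hK rK.
have [Ks KsE] := kernel_of_form _ _ fs hK sK.
have {}KrE : kernel_form Kr = tr by apply/funext => f; apply/funext => g.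
have {}KsE : kernel_form Ks = ts by apply/funext => f; apply/funext => g.
exists Kr, Ks; rewrite /is_kernel /kernel_closable /kernel_singular KrE KsE.
split => //; apply: kernel_ext => f g.
by rewrite kernel_formD KE KrE KsE.
Qed.
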